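(* Let $C$ be a set of untranslated join-irreducible permutations (of various sizes). A permutation $x\in S_n$ is contracted by $\mathcal{H}(C)_n$ if and only if for some $\gamma\in C$ there is a scramble $\sigma$ of $\gamma$ which occurs in $x$ with adjacent cliff.
   Context: $S_n$: permutations of $[n]$ in one-line notation $x_1\cdots x_n$ with the right weak order ($x\le y$ iff the set of inverted value pairs of $x$ is contained in that of $y$; covers swap adjacent entries to create an inversion), a lattice. A join-irreducible of $S_n$ is a permutation with exactly one descent $x_i>x_{i+1}$; it covers exactly one element $\gamma_*$. Its associated subset is $A=\{\gamma_{i+1},\dots,\gamma_n\}$ (where $i$ is the descent), $m=\min A$, $M=\max([n]\setminus A)$; $\gamma$ is the elements of $[n]\setminus A$ increasing followed by those of $A$ increasing. For $u\in S_p,v\in S_q$, $u\times v=u_1\cdots u_p(p+v_1)\cdots(p+v_q)$; $1_k$ is the identity of $S_k$. A permutation $x\in S_n$ is untranslated if $x_1>1$ and $x_n<n$; an untranslated join-irreducible $\gamma\in S_k$ has $\gamma_j=k$, $\gamma_{j+1}=1$ at its descent $j$. For such $\gamma$, a scramble is any $\sigma\in S_k$ with $\sigma_j=k$, $\sigma_{j+1}=1$ and $\{\sigma_1,..,\sigma_{j-1}\}=\{\gamma_1,..,\gamma_{j-1}\}$. A permutation $y\in S_k$ with $y_j=k,y_{j+1}=1$ occurs in $x\in S_n$ with adjacent cliff if there are $i_1<\dots<i_k$ with $x_{i_p}<x_{i_q}\iff y_p<y_q$ for all $p,q$, and $i_{j+1}=i_j+1$. A congruence $\Theta$ on $S_n$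 contracts $x$ if $x\equiv y$ for some $y$ covered by $x$; it contracts a join-irreducible $\gamma$ if $\gamma\equiv\gamma_*$. $\mathrm{st}(a_1..a_k)$ is the $u\in S_k$ with $u_i<u_j\iff a_i<a_j$. A family $\{\Theta_n\}_{n\ge0}$ of congruences on $S_n$ is translational if $u\times v\equiv u'\times v'$ mod $\Theta_{p+q}$ iff $u\equiv u'$ mod $\Theta_p$ and $v\equiv v'$ mod $\Theta_q$; insertional if for every $p$-subset $Q\subseteq[p+q]$, with $\varphi_Q(u,v)$ the unique $x\in S_{p+q}$ with $\{x_1..x_p\}=Q$, $\mathrm{st}(x_1..x_p)=u$, $\mathrm{st}(x_{p+1}..x_{p+q})=v$, we have $u\equiv u',v\equiv v'\Rightarrow\varphi_Q(u,v)\equiv\varphi_Q(u',v')$; an $\mathcal{H}$-family if both. $\{\mathcal{H}(C)_n\}_{n\ge0}$ is the smallest $\mathcal{H}$-family contracting every element of $C$. *)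

(* Defs.v *)
From mathcomp Require Import all_boot.
Set Implicit Arguments. Unset Strict Implicit. Unset Printing Implicit Defensive.

(* x is an element of S_n in one-line notation x_1 ... x_n (values 1..n);
   position i (1-indexed) is nth 0 x (i-1). *)
Definition is_perm (n : nat) (x : seq nat) : bool :=
  (size x == n) && perm_eq x (iota 1 n).

Definition inv_pair (x : seq nat) (a b : nat) : bool :=
  (a < b) && (a \in x) && (b \in x) && (index b x < index a x).

Definition weak_le (x y : seq nat) : Prop :=
  forall a b, inv_pair x a b -> inv_pair y a b.

Definition swap_adj (x : seq nat) (i : nat) : seq nat :=
  take i x ++ nth 0 x i.+1 :: nth 0 x i :: drop i.+2 x.

Definition covered_by (y x : seq nat) : Prop :=
  exists i, i.+1 < size y /\ nth 0 y i < nth 0 y i.+1 /\ x = swap_adj y i.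

Definition descents (x : seq nat) : nat :=
  count (fun i => nth 0 x i.+1 < nth 0 x i) (iota 0 (size x).-1).

Definition join_irreducible (x : seq nat) : Prop :=
  is_perm (size x) x /\ descents x = 1.

Definition untranslated (x : seq nat) : Prop :=
  1 < nth 0 x 0 /\ nth 0 x (size x).-1 < size x.

(* Scramble sigma of an untranslated join-irreducible gamma in S_k:
   with j the (0-indexed) descent position of gamma, gamma_j = k, gamma_{j+1} = 1,
   sigma_j = k, sigma_{j+1} = 1, and {sigma before j} = {gamma before j}. *)
Definition scramble (gamma sigma : seq nat) : Prop :=
  let k := size gamma in
  is_perm k sigma /\
  exists j, j.+1 < k /\ nth 0 gamma j = k /\ nth 0 gamma j.+1 = 1 /\
    nth 0 sigma j = k /\ nth 0 sigma j.+1 = 1 /\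
    perm_eq (take j sigma) (take j gamma).

Definition occurs_adj_cliff (y x : seq nat) : Prop :=
  let k := size y in
  exists idx : seq nat,
    [/\ size idx = k, sorted ltn idx, all (fun i => i < size x) idx,
     (forall p q, p < k -> q < k ->
        (nth 0 x (nth 0 idx p) < nth 0 x (nth 0 idx q)) = (nth 0 y p < nth 0 y q)) &
     exists j, [/\ j.+1 < k, nth 0 y j = k, nth 0 y j.+1 = 1 &
                nth 0 idx j.+1 = (nth 0 idx j).+1]].

Definition is_join (n : nat) (x y z : seq nat) : Prop :=
  is_perm n z /\ weak_le x z /\ weak_le y z /\
  forall w, is_perm n w -> weak_le x w -> weak_le y w -> weak_le z w.

Definition is_meet (n : nat) (x y z : seq nat) : Prop :=
  is_perm n z /\ weak_le z x /\ weak_le z y /\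
  forall w, is_perm n w -> weak_le w x -> weak_le w y -> weak_le w z.

Definition congruence (n : nat) (R : seq nat -> seq nat -> Prop) : Prop :=
  [/\ (forall x, is_perm n x -> R x x),
      (forall x y, is_perm n x -> is_perm n y -> R x y -> R y x),
      (forall x y z, is_perm n x -> is_perm n y -> is_perm n z ->
          R x y -> R y z -> R x z),
      (forall x y z j j', is_perm n x -> is_perm n y -> is_perm n z ->
          R x y -> is_join n x z j -> is_join n y z j' -> R j j') &
      (forall x y z m m', is_perm n x -> is_perm n y -> is_perm n z ->
          R x y -> is_meet n x z m -> is_meet n y z m' -> R m m')].

Definition family := nat -> seq nat -> seq nat -> Prop.

Definition cross (p : nat) (u v : seq nat) : seq nat := u ++ map (addn p) v.

Definition translational (T : family) : Prop :=
  forall p q u u' v v', is_perm p u -> is_perm p u' -> is_perm q v -> is_perm q v' ->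
    (T (p + q) (cross p u v) (cross p u' v') <-> T p u u' /\ T q v v').

(* phi_Q(u,v), Q given as the increasing list of its elements *)
Definition phiQ (p q : nat) (Q u v : seq nat) : seq nat :=
  let Qc := [seq i <- iota 1 (p + q) | i \notin Q] in
  map (fun i => nth 0 Q i.-1) u ++ map (fun i => nth 0 Qc i.-1) v.

Definition insertional (T : family) : Prop :=
  forall p q (Q : seq nat), sorted ltn Q -> all (fun i => 0 < i <= p + q) Q ->
    size Q = p ->
  forall u u' v v', is_perm p u -> is_perm p u' -> is_perm q v -> is_perm q v' ->
    T p u u' -> T q v v' -> T (p + q) (phiQ p q Q u v) (phiQ p q Q u' v').

Definition H_family (T : family) : Prop :=
  (forall n, congruence n (T n)) /\ translational T /\ insertional T.

Definition contracts (T : family) (n : nat) (x : seq nat) : Prop :=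
  exists y, covered_by y x /\ T n x y.

Definition H_of (C : seq nat -> Prop) : family :=
  fun n x y => forall T, H_family T ->
    (forall g, C g -> contracts T (size g) g) -> T n x y.

(* Main.v *)
(* A descent b a of x (with a < b) is recorded by the word telling, for each value c
   strictly between a and b, whether c stands to the left of b a. A scramble of g occurs
   with its cliff at b a exactly when the word of g is a subword of that word.

   For a set W of words, call a join-irreducible contracted when its word has a subword
   in W, and let x ~ y mean that the same uncontracted join-irreducibles lie below x and
   below y. Compatibility with meets is immediate; compatibility with joins follows from
   the fact that ~ is equally described by the uncontracted meet-irreducibles above x and
   y. This gives an H-family which contracts an edge iff the word of the edge has a
   subword in W, hence the pattern is necessary.

   Conversely, insertionality applied twice shows that any H-family contracting g
   contracts an edge where g occurs contiguously, between the entries that stand left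
   and right of the descent. Every other edge with the same a, b and the same sets of
   entries on the left and on the right is perspective to it. *)
From mathcomp Require Import all_boot zify.
From Stdlib Require Import Classical.
Require Import Defs.
Set Implicit Arguments. Unset Strict Implicit. Unset Printing Implicit Defensive.

(** * Permutations as sequences, and their inverted pairs *)

Lemma is_perm_mem n x c : is_perm n x -> (c \in x) = (0 < c <= n).
Proof. by case/andP=> _ /perm_mem ->; rewrite mem_iota; lia. Qed.

Lemma is_perm_uniq n x : is_perm n x -> uniq x.
Proof. by case/andP=> _ /perm_uniq ->; rewrite iota_uniq. Qed.

Lemma is_perm_size n x : is_perm n x -> size x = n.
Proof. by case/andP=> /eqP. Qed.

Lemma is_perm_eq n x y : perm_eq x y -> is_perm n x -> is_perm n y.
Proof.
move=> e /andP[sz p]; rewrite /is_perm -(perm_size e) sz /=.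
by rewrite -(permPl e).
Qed.

Lemma inv_pair_cat (A B : seq nat) c d : uniq (A ++ B) ->
  inv_pair (A ++ B) c d =
  [|| inv_pair A c d, inv_pair B c d | [&& c < d, d \in A & c \in B]].
Proof.
rewrite cat_uniq => /and3P[_ /hasPn dis _].
rewrite /inv_pair !mem_cat !index_cat.
have := dis c; have := dis d.
have := index_mem c A; have := index_mem d A.
case: (c \in A); case: (d \in A); case: (c \in B); case: (d \in B) => /= *; lia.
Qed.

Lemma index_map_in (f : nat -> nat) (s : seq nat) i : {in s &, injective f} -> i \in s ->
  index (f i) (map f s) = index i s.
Proof.
elim: s => //= k s IH fi; rewrite inE; case: (eqVneq k i) => [-> _|ki /= si].
  by rewrite eqxx.
rewrite ifN ?IH // => [j l js ls|]; first by apply: fi; rewrite inE ?js ?ls orbT.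
by apply: contraNneq ki => e; apply/eqP/fi; rewrite ?inE ?eqxx ?si ?orbT.
Qed.

Lemma mono_ltn_inj (f : nat -> nat) (s : seq nat) : {in s &, {mono f : i j / i < j}} ->
  {in s &, injective f}.
Proof.
move=> fm i j si sj e; have := fm i j si sj; have := fm j i sj si; rewrite e; lia.
Qed.

Lemma inv_pair_map f u c d : {in u &, {mono f : i j / i < j}} ->
  c \in u -> d \in u -> inv_pair (map f u) (f c) (f d) = inv_pair u c d.
Proof.
move=> fm cu du.
have fi : {in u &, injective f} by exact: mono_ltn_inj.
by rewrite /inv_pair !map_f // !(index_map_in fi) // fm // cu du.
Qed.

Lemma inv_pair_sorted s c d : sorted leq s -> uniq s -> inv_pair s c d = false.
Proof.
move=> ss us; apply/negP => /andP[/andP[/andP[cd cs] ds] i].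
have := sorted_leq_nth leq_trans leqnn 0 ss.
move=> /(_ (index d s) (index c s)); rewrite !inE !index_mem cs ds => /(_ isT isT (ltnW i)).
by rewrite !nth_index //; lia.
Qed.

(** * The congruence defined by a set of words *)

Section WordCongruence.
Variable W : seq bool -> Prop.

(* When L fails at a and holds at b, the join-irreducible of the descent b a whose entries
   of ]a, b[ on the left are those satisfying L lies below x iff x inverts all these pairs. *)
Definition inverts (x : seq nat) a b (L : pred nat) :=
  forall c d, a <= c -> c < d -> d <= b -> ~~ L c -> L d -> inv_pair x c d.

(* Dually, when L holds at a and fails at b: x lies below the corresponding meet-irreducible. *)
Definition preserves (x : seq nat) a b (L : pred nat) :=
  forall c d, a <= c -> c < d -> d <= b -> L c -> ~~ L d -> ~~ inv_pair x c d.

(** The word of [a], [b], [L] lists the values of [L] on ]a, b[ in increasing order of the entries;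
    [s] selects the letters of a subword. *)
Definition word_contracted a b (L : pred nat) :=
  exists s, [/\ W (map L s), sorted ltn s & all (fun c => a < c < b) s].

(** A triple [a], [b], [L] encodes a join-irreducible with minimum [a] of its right part and maximum
    [b] of its left part. Predicates that agree on [a, b] encode the same one, so no normal form is
    chosen. *)
Definition word_cong : family := fun n x y =>
  forall a b (L : pred nat), 0 < a -> a < b -> b <= n -> ~~ L a -> L b -> ~ word_contracted a b L ->
    (inverts x a b L <-> inverts y a b L).

(** An increasing map that respects letters carries subwords to subwords. It serves for shrinking
    intervals, for insertions and for shifts. *)
Lemma word_contracted_map f a b a' b' (L L' : pred nat) :
  (forall i, a < i < b -> a' < f i < b' /\ L' (f i) = L i) ->
  (forall i j, a < i -> i < j -> j < b -> f i < f j) ->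
  word_contracted a b L -> word_contracted a' b' L'.
Proof.
move=> fab fm [s [Ws ss sab]]; exists (map f s); split.
- by rewrite -map_comp (eq_in_map (L' \o f) L s).1 // => i /(allP sab)/fab[].
- elim: s ss sab {Ws} => //= i [|j s] IH //= /andP[ij ss] /and3P[ai aj sab].
  by apply/andP; split; [apply: fm; lia | apply: IH; rewrite //= aj].
- by rewrite all_map; apply/allP => i /(allP sab)/fab[].
Qed.

Lemma word_contracted_sub a b c d (L L' : pred nat) : a <= c -> d <= b ->
  (forall e, c < e < d -> L' e = L e) -> word_contracted c d L' -> word_contracted a b L.
Proof.
move=> ac db LL; apply: (@word_contracted_map id) => // i icd.
by split; [lia | rewrite LL].
Qed.

(* The closest pair c, d violating [preserves] has every entry of ]c, d[ placed so that
   [inverts] holds on [c, d], for the restriction of L. *)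
Lemma preserves_cong n x y a b (L : pred nat) : is_perm n y ->
  word_cong n x y -> ~ word_contracted a b L -> preserves x a b L -> preserves y a b L.
Proof.
move=> py xy nc px c d; have [k] := ubnP (d - c); elim: k c d => // k IH c d dck.
move=> ac cd db Lc Ld; apply/negP => icd.
(* The values at the two ends are exchanged, so that [c] counts as right and [d] as left. Nothing
   changes on ]c, d[, so the new word is a subword of the old one and stays uncontracted. *)
pose L' e := if e == c then false else if e == d then true else L e.
have iy : inverts y c d L'.
  move=> c' d' cc' cd' dd' Lc' Ld'.
  move: icd; rewrite /inv_pair !(is_perm_mem _ py) => /andP[/andP[/andP[_ cn] dn] idc].
  have c'd : c' != d by lia.
  have d'c : d' != c by lia.
  (* Were [c'] left of [c] in [y], the pair [c], [c'] would be a closer violation. *)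
  have le1 : index c y <= index c' y.
    case: (eqVneq c' c) Lc' => [-> //|cn' ].
    rewrite /L' (negPf cn') (negPf c'd) => Lc'.
    have := IH c c'; rewrite /inv_pair !(is_perm_mem _ py); lia.
  have le2 : index d' y <= index d y.
    case: (eqVneq d' d) Ld' => [-> //|dn' ].
    rewrite /L' (negPf dn') (negPf d'c) => Ld'.
    have := IH d' d; rewrite /inv_pair !(is_perm_mem _ py); lia.
  lia.
have Ll : L' c = false by rewrite /L' eqxx.
have Lr : L' d by rewrite /L' eqxx; case: eqP => //; lia.
have nc' : ~ word_contracted c d L'.
  move=> h; apply: nc; apply: (word_contracted_sub ac db _ h) => e ecd.
  by rewrite /L' !ifN //; lia.
have [c0 dn] : 0 < c /\ d <= n.
  by move: icd; rewrite /inv_pair !(is_perm_mem _ py); lia.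
have ix := (xy c d L' c0 cd dn (negbT Ll) Lr nc').2 iy.
by have := px c d ac cd db Lc Ld; rewrite (ix c d) ?Ll.
Qed.

(** The dual argument: if [c], [d] is the closest pair that [y] fails to invert, the entries of ]c,
    d[ sit in [y] so that [preserves] holds on [c, d]. It then holds for [x], against the inversion
    of [c], [d] in [x]. *)
Lemma inverts_cong n x y a b (L : pred nat) : is_perm n x -> is_perm n y ->
  (forall a b (L : pred nat), 0 < a -> a < b -> b <= n -> L a -> ~~ L b -> ~ word_contracted a b L ->
     preserves y a b L -> preserves x a b L) ->
  ~ word_contracted a b L -> inverts x a b L -> inverts y a b L.
Proof.
move=> px py xy nc ix c d; have [k] := ubnP (d - c); elim: k c d => // k IH c d dck.
move=> ac cd db Lc Ld; apply: contraT => nicd.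
have icd := ix _ _ ac cd db Lc Ld.
pose L' e := if e == c then true else if e == d then false else L e.
have iy : preserves y c d L'.
  move=> c' d' cc' cd' dd' Lc' Ld'.
  move: (icd) nicd; rewrite /inv_pair !(is_perm_mem _ py) !(is_perm_mem _ px).
  move=> /andP[/andP[/andP[_ cn] dn] _] nicd.
  have c'd : c' != d by lia.
  have d'c : d' != c by lia.
  have le1 : index c' y <= index c y.
    case: (eqVneq c' c) Lc' => [-> //|cn' ].
    rewrite /L' (negPf cn') (negPf c'd) => Lc'.
    have := IH c c'; rewrite /inv_pair !(is_perm_mem _ py); lia.
  have le2 : index d y <= index d' y.
    case: (eqVneq d' d) Ld' => [-> //|dn' ].
    rewrite /L' (negPf dn') (negPf d'c) => Ld'.
    have := IH d' d; rewrite /inv_pair !(is_perm_mem _ py); lia.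
  lia.
have Ll : L' c by rewrite /L' eqxx.
have Lr : L' d = false by rewrite /L' eqxx; case: eqP => //; lia.
have nc' : ~ word_contracted c d L'.
  move=> h; apply: nc; apply: (word_contracted_sub ac db _ h) => e ecd.
  by rewrite /L' !ifN //; lia.
have [c0 dn] : 0 < c /\ d <= n.
  by move: icd; rewrite /inv_pair !(is_perm_mem _ px); lia.
have ip := xy c d L' c0 cd dn Ll (negbT Lr) nc' iy.
have := ip c d (leqnn _) cd (leqnn _) Ll; rewrite Lr icd; exact.
Qed.

Lemma word_cong_sym n x y : word_cong n x y -> word_cong n y x.
Proof. by move=> h a b L a0 ab bn La Lb nc; rewrite (h a b L). Qed.

(** Every join-irreducible has this shape, with [P] describing its left part. *)
Lemma is_perm_split n (P : pred nat) :
  is_perm n ([seq c <- iota 1 n | P c] ++ [seq c <- iota 1 n | ~~ P c]).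
Proof.
have e : perm_eq (filter P (iota 1 n) ++ filter (predC P) (iota 1 n)) (iota 1 n).
  by rewrite perm_filterC.
by rewrite /is_perm (perm_size e) size_iota eqxx.
Qed.

Lemma inv_pair_split n (P : pred nat) c d :
  inv_pair ([seq c <- iota 1 n | P c] ++ [seq c <- iota 1 n | ~~ P c]) c d =
  [&& 0 < c, c < d, d <= n, ~~ P c & P d].
Proof.
rewrite inv_pair_cat; last exact: is_perm_uniq (is_perm_split n P).
rewrite !inv_pair_sorted ?filter_uniq ?iota_uniq //;
  try by apply: sorted_filter; [exact: leq_trans | exact: iota_sorted].
rewrite !mem_filter !mem_iota /=; case: (P c); case: (P d) => /=; lia.
Qed.

Lemma inv_pair_rev n x c d : is_perm n x ->
  inv_pair (rev x) c d = [&& 0 < c, c < d, d <= n & ~~ inv_pair x c d].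
Proof.
move=> px; rewrite /inv_pair !mem_rev !(is_perm_mem _ px).
case: (ltnP c d) => cd; last by lia.
case: (boolP (0 < c <= n)) => cn /=; last by lia.
case: (boolP (0 < d <= n)) => dn /=; last by lia.
have [cx dx] : c \in x /\ d \in x by rewrite !(is_perm_mem _ px).
have ux := is_perm_uniq px.
have ir (i : nat) : i \in x -> index i (rev x) = size x - (index i x).+1.
  move=> ix; rewrite -{1}(nth_index 0 ix) -{1}(revK x) nth_rev ?size_rev ?index_mem //.
  by rewrite index_uniq ?rev_uniq // size_rev; move: ix; rewrite -index_mem; lia.
have ne : index c x != index d x.
  by apply/eqP => e; move: cd; rewrite -(nth_index 0 cx) e nth_index // ltnn.
rewrite !ir //; move/eqP: ne; move: cx dx; rewrite -!index_mem.
move: (index c x) (index d x) (size x) => i j k. lia.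
Qed.

(** Once [inverts] means lying above one fixed permutation, the universal property of meets applies
    to it. *)
Lemma ji_exists n a b (L : pred nat) : 0 < a -> b <= n ->
  exists2 j, is_perm n j & forall x, inverts x a b L <-> weak_le j x.
Proof.
(* Values below [a] go left and values above [b] go right, so the inverted pairs are exactly those
   that [inverts] demands. *)
move=> a0 bn; pose P c := (c < a) || (c <= b) && L c.
exists ([seq c <- iota 1 n | P c] ++ [seq c <- iota 1 n | ~~ P c]).
  exact: is_perm_split.
move=> x; split=> [ix c d | jx c d ac cd db Lc Ld].
  rewrite inv_pair_split /P => h; apply: ix; move: h; case: (L c); case: (L d); lia.
by apply: jx; rewrite inv_pair_split /P; move: Lc Ld; case: (L c); case: (L d); lia.
Qed.

Lemma is_perm_rev n x : is_perm n (rev x) = is_perm n x.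
Proof. by rewrite /is_perm size_rev perm_rev. Qed.

(** Reversal complements the inversion set: the pairs that [rev s] leaves in order are the inverted
    pairs of [s], and [P] is chosen so that these are the pairs forbidden by [preserves]. *)
Lemma mi_exists n a b (L : pred nat) : 0 < a -> b <= n ->
  exists2 m, is_perm n m &
    forall x, is_perm n x -> (preserves x a b L <-> weak_le x m).
Proof.
move=> a0 bn; pose P c := ~~ ((b < c) || (a <= c) && L c).
pose s := ([seq c <- iota 1 n | P c] ++ [seq c <- iota 1 n | ~~ P c]).
have ps : is_perm n s by exact: is_perm_split.
exists (rev s); first by rewrite is_perm_rev.
move=> x px; split=> [ix c d icd | jx c d ac cd db Lc Ld].
  rewrite (inv_pair_rev _ _ ps) inv_pair_split.
  have := ix c d; rewrite icd /=; move: icd; rewrite /inv_pair !(is_perm_mem _ px) /P.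
  case: (L c); case: (L d); lia.
apply/negP => /jx; rewrite (inv_pair_rev _ _ ps) inv_pair_split /P.
by move: Lc Ld; case: (L c); case: (L d); lia.
Qed.

Lemma preserves_join n x y m a b L : is_perm n x -> is_perm n y ->
  0 < a -> b <= n -> is_join n x y m ->
  preserves m a b L <-> preserves x a b L /\ preserves y a b L.
Proof.
move=> px py a0 bn [pm [xm [ym mm]]]; have [w pw hw] := mi_exists L a0 bn.
rewrite !hw //; split=> [mw|[xw yw]]; last exact: mm.
by split=> c d i; apply: mw; [apply: xm | apply: ym].
Qed.

Lemma inverts_meet n x y m a b L :
  0 < a -> b <= n -> is_meet n x y m ->
  inverts m a b L <-> inverts x a b L /\ inverts y a b L.
Proof.
move=> a0 bn [pm [xm [ym mm]]]; have [w pw hw] := ji_exists L a0 bn.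
rewrite !hw //; split=> [mw|[xw yw]]; last exact: mm.
by split=> c d i; [apply: xm | apply: ym]; apply: mw.
Qed.


(** With this dual description, compatibility with joins becomes the mirror image of compatibility
    with meets. *)
Lemma word_cong_preserves n x y : is_perm n x -> is_perm n y ->
  (word_cong n x y <->
   forall a b (L : pred nat), 0 < a -> a < b -> b <= n -> L a -> ~~ L b -> ~ word_contracted a b L ->
     preserves x a b L <-> preserves y a b L).
Proof.
move=> px py; split=> [xy a b L a0 ab bn La Lb nc | h a b L a0 ab bn La Lb nc].
  split; [exact: preserves_cong xy nc | exact: preserves_cong (word_cong_sym xy) nc].
split; [apply: (inverts_cong px py) nc | apply: (inverts_cong py px) nc];
  by move=> a' b' L' a'0 ab' bn' La' Lb' nc'; case: (h a' b' L').
Qed.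

Lemma word_cong_congruence n : congruence n (word_cong n).
Proof.
split=> [x px a b L * | x y px py | x y z px py pz xy yz a b L a0 ab bn La Lb nc
  | x y z j j' px py pz xy jx jy | x y z m m' px py pz xy mx my a b L a0 ab bn La Lb nc].
- by [].
- exact: word_cong_sym.
- by rewrite (xy a b L) // (yz a b L).
- apply/word_cong_preserves; [exact: jx.1 | exact: jy.1 |] => a b L a0 ab bn La Lb nc.
  rewrite (preserves_join _ px pz a0 bn jx) (preserves_join _ py pz a0 bn jy).
  by rewrite ((word_cong_preserves px py).1 xy).
- by rewrite (inverts_meet _ a0 bn mx) (inverts_meet _ a0 bn my) (xy a b L).
Qed.

End WordCongruence.

(** * Cover edges contracted by the word congruence *)

Lemma inv_pair_swap l a b r c d : uniq (l ++ b :: a :: r) -> a < b ->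
  inv_pair (l ++ b :: a :: r) c d =
  inv_pair (l ++ a :: b :: r) c d || (c == a) && (d == b).
Proof.
move=> ux ab.
have uy : uniq (l ++ a :: b :: r).
  by rewrite (perm_uniq (s2 := l ++ b :: a :: r)) // perm_cat2l (perm_catCA [:: a] [:: b]).
have uq s t (A : seq nat) : uniq (A ++ s ++ t) -> uniq (s ++ t) by rewrite cat_uniq => /and3P[].
rewrite -![_ :: _ :: r]/([:: _; _] ++ r) in ux uy *.
rewrite !inv_pair_cat ?(uq _ _ _ ux) ?(uq _ _ _ uy) //.
rewrite !mem_cat /inv_pair !inE /=.
rewrite ![_ == c]eq_sym ![_ == d]eq_sym.
by case: (eqVneq c a); case: (eqVneq d a); case: (eqVneq c b); case: (eqVneq d b) => /= *; lia.
Qed.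

(** The two ends differ only in the pair [a], [b]. A join-irreducible that separates them lives on
    an interval containing [a, b], and on ]a, b[ its predicate must agree with membership in [l]; so
    its word contains the word of the edge. Conversely the word of the edge itself yields a
    separating join-irreducible. *)
Lemma swap_word_cong (W : seq bool -> Prop) n l a b r :
  is_perm n (l ++ b :: a :: r) -> a < b ->
  word_cong W n (l ++ b :: a :: r) (l ++ a :: b :: r) <-> word_contracted W a b (fun c => c \in l).
Proof.
move=> px ab; have ux := is_perm_uniq px.
have sw := inv_pair_swap _ _ ux ab.
have [/andP[a0 an] /andP[b0 bn]] : 0 < a <= n /\ 0 < b <= n.
  by rewrite -!(is_perm_mem _ px) !mem_cat !inE !eqxx !orbT.
have lab c : c \in l -> index c (l ++ b :: a :: r) < size l.
  by move=> cl; rewrite index_cat cl index_mem.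
have rab c : c \notin l -> size l <= index c (l ++ b :: a :: r).
  by move=> cl; rewrite index_cat (negPf cl) leq_addr.
have [bl al] : b \notin l /\ a \notin l.
  move: ux; rewrite cat_uniq => /and3P[_ /hasPn h _].
  by split; apply: h; rewrite !inE eqxx ?orbT.
have ib : index b (l ++ b :: a :: r) = size l by rewrite index_cat (negPf bl) /= eqxx addn0.
have ia : index a (l ++ b :: a :: r) = (size l).+1.
  by rewrite index_cat (negPf al) /= eqxx gtn_eqF // addn1.
split=> [xy | ct a' b' L a'0 ab' bn' La Lb nc].
  apply: NNPP => nc.
  (* The entry [b] belongs to the left part of the join-irreducible, but not to [l]. *)
  pose L c := (c \in l) || (c == b).
  have La : ~~ L a by rewrite /L negb_or al ltn_eqF.
  have Lb : L b by rewrite /L eqxx orbT.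
  have nc' : ~ word_contracted W a b L.
    move=> h; apply: nc; apply: word_contracted_sub h => // e eab.
    by rewrite /L [e == b]ltn_eqF ?orbF //; lia.
  have ix : inverts (l ++ b :: a :: r) a b L.
    move=> c d ac cd db; rewrite /L negb_or => /andP[cl cb] Ld.
    rewrite /inv_pair !(is_perm_mem _ px) cd.
    have le1 : index d (l ++ b :: a :: r) <= size l.
      by case/orP: Ld => [/lab/ltnW //|/eqP->]; rewrite ib.
    have := rab c cl; rewrite leq_eqVlt => /predU1P[e|]; last lia.
    have cx : c \in l ++ b :: a :: r by rewrite (is_perm_mem _ px); lia.
    by case/eqP: cb; rewrite -(nth_index 0 cx) -e -ib nth_index // (is_perm_mem _ px) b0 bn.
  have i := (xy a b L a0 ab bn La Lb nc').1 ix a b (leqnn a) ab (leqnn b) La Lb.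
  have : inv_pair (l ++ a :: b :: r) a b = false; last by rewrite i.
  rewrite /inv_pair !index_cat (negPf al) (negPf bl) /= !eqxx ltn_eqF //; lia.
split=> [ix c d ac cd db Lc Ld | iy c d ac cd db Lc Ld]; last first.
  by rewrite sw iy.
have := ix c d ac cd db Lc Ld; rewrite sw => /orP[//|/andP[/eqP ec /eqP ed]]; subst c d.
case: nc; apply: word_contracted_sub ct => // e eab.
(* If [L] holds at [e], the inverted pair [a], [e] puts [e] before [a], hence into [l] since [e] is
   not [b]. Otherwise the inverted pair [e], [b] puts [e] after [b], hence outside [l]. *)
have [ae [eb [ea be]]] : a < e /\ e < b /\ e <= b' /\ a' <= e by lia.
case: (boolP (L e)) => Le.
  have := ix a e ac ae ea Lc Le; rewrite /inv_pair ia.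
  case: (boolP (e \in l)) => // el; have := rab e el.
  move=> h1 /andP[/andP[_ ex] h2].
  have e1 : index e (l ++ b :: a :: r) = index b (l ++ b :: a :: r)
    by apply/eqP; rewrite ib eqn_leq h1 andbT -ltnS.
  have : e = b by rewrite -(nth_index 0 ex) e1 nth_index // (is_perm_mem _ px) b0 bn.
  by move=> ee; move: eb; rewrite ee ltnn.
have := ix e b be eb db Le Ld; rewrite /inv_pair ib.
by case: (boolP (e \in l)) => // /lab el /andP[_]; rewrite ltnNge ltnW.
Qed.

(** * Inverted pairs of an insertion *)

Lemma perm_map_nth n s u : size s = n -> is_perm n u ->
  perm_eq (map (fun i => nth 0 s i.-1) u) s.
Proof.
move=> sn /andP[_ pu].
have e : map (fun i => nth 0 s i.-1) (iota 1 n) = s.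
  apply: (@eq_from_nth _ 0); rewrite size_map size_iota // => i i_n.
  by rewrite (nth_map 0) ?size_iota // nth_iota.
by rewrite -[X in perm_eq _ X]e perm_map.
Qed.

Lemma nth_pred_mono s i j : sorted ltn s -> 0 < i -> i < j -> j <= size s ->
  nth 0 s i.-1 < nth 0 s j.-1.
Proof.
by move=> ss i0 ij js; apply: (sorted_ltn_nth ltn_trans 0 ss); rewrite ?inE; lia.
Qed.

Section PhiQ.
Variables (p q : nat) (Q : seq nat).
Hypotheses (sQ : sorted ltn Q) (aQ : all (fun i => 0 < i <= p + q) Q) (szQ : size Q = p).

Definition Qcompl := [seq i <- iota 1 (p + q) | i \notin Q].

Lemma sorted_compl : sorted ltn Qcompl.
Proof. by apply: sorted_filter; [exact: ltn_trans | exact: iota_ltn_sorted]. Qed.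

Lemma uniq_Q : uniq Q.
Proof. exact: sorted_uniq ltn_trans ltnn _ sQ. Qed.

Lemma perm_Q_compl : perm_eq (Q ++ Qcompl) (iota 1 (p + q)).
Proof.
have e : perm_eq (filter (mem Q) (iota 1 (p + q)) ++ Qcompl) (iota 1 (p + q)).
  by rewrite perm_filterC.
rewrite -(permPr e) perm_cat2r.
apply: uniq_perm; [exact: uniq_Q | by rewrite filter_uniq ?iota_uniq | move=> i].
rewrite mem_filter mem_iota /=; case: (boolP (i \in Q)) => //= /(allP aQ); lia.
Qed.

Lemma size_compl : size Qcompl = q.
Proof.
by apply/eqP; rewrite -(eqn_add2l p) -{1}szQ -size_cat (perm_size perm_Q_compl) size_iota.
Qed.

Variables (u v : seq nat).
Hypotheses (pu : is_perm p u) (pv : is_perm q v).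

Lemma perm_phiQl : perm_eq (map (fun i => nth 0 Q i.-1) u) Q.
Proof. exact: perm_map_nth szQ pu. Qed.

Lemma perm_phiQr : perm_eq (map (fun i => nth 0 Qcompl i.-1) v) Qcompl.
Proof. exact: perm_map_nth size_compl pv. Qed.

Lemma is_perm_phiQ : is_perm (p + q) (phiQ p q Q u v).
Proof.
rewrite /is_perm.
have e : perm_eq (phiQ p q Q u v) (iota 1 (p + q)).
  apply: perm_trans perm_Q_compl.
  apply: perm_trans (perm_cat perm_phiQl perm_phiQr); exact: perm_refl.
by rewrite e (perm_size e) size_iota eqxx.
Qed.

Let uc := is_perm_uniq is_perm_phiQ.

Lemma phiQ_disjoint c : c \in Q -> c \in Qcompl = false.
Proof. by rewrite mem_filter => ->. Qed.

(** The right-hand side does not mention [u] and [v]: changing the arguments of the insertion never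
    affects a pair split between [Q] and its complement. *)
Lemma inv_pair_phiQ_mixed c d : (c \in Q) != (d \in Q) ->
  inv_pair (phiQ p q Q u v) c d = [&& c < d, d \in Q & c \in Qcompl].
Proof.
rewrite inv_pair_cat ?uc // /inv_pair.
rewrite !(perm_mem perm_phiQl) !(perm_mem perm_phiQr) => cd.
have := @phiQ_disjoint c; have := @phiQ_disjoint d; move: cd.
case: (c \in Q); case: (d \in Q) => //= _.
  by move=> _ /(_ isT)->; rewrite !andbF.
by move=> /(_ isT)-> _; rewrite !andbF.
Qed.

Lemma inv_pair_phiQl i j : 0 < i <= p -> 0 < j <= p ->
  inv_pair (phiQ p q Q u v) (nth 0 Q i.-1) (nth 0 Q j.-1) = inv_pair u i j.
Proof.
move=> ip jp; rewrite inv_pair_cat ?uc //.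
have ru k : k \in u -> 0 < k <= p by rewrite (is_perm_mem _ pu).
rewrite (inv_pair_map (f := fun i => nth 0 Q i.-1)) ?(is_perm_mem _ pu) //; last first.
  move=> k l /ru kp /ru lp; have [kl|kl|->] := ltngtP k l; last by rewrite ltnn.
    by apply: nth_pred_mono; rewrite ?szQ //; lia.
  by apply/negbTE; rewrite -leqNgt ltnW //; apply: nth_pred_mono; rewrite ?szQ //; lia.
rewrite /inv_pair !(perm_mem perm_phiQr).
rewrite (phiQ_disjoint (c := nth 0 Q i.-1)) ?mem_nth ?szQ //; last lia.
by rewrite !(andbF, orbF).
Qed.

Lemma inv_pair_phiQr i j : 0 < i <= q -> 0 < j <= q ->
  inv_pair (phiQ p q Q u v) (nth 0 Qcompl i.-1) (nth 0 Qcompl j.-1) = inv_pair v i j.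
Proof.
move=> ip jp; rewrite inv_pair_cat ?uc //.
have ru k : k \in v -> 0 < k <= q by rewrite (is_perm_mem _ pv).
have sc := size_compl.
rewrite (inv_pair_map (f := fun i => nth 0 Qcompl i.-1)) ?(is_perm_mem _ pv) //; last first.
  move=> k l /ru kp /ru lp; have [kl|kl|->] := ltngtP k l; last by rewrite ltnn.
    by apply: nth_pred_mono; rewrite ?sorted_compl ?sc //; lia.
  apply/negbTE; rewrite -leqNgt ltnW //; apply: nth_pred_mono; rewrite ?sorted_compl ?sc //; lia.
rewrite /inv_pair !(perm_mem perm_phiQl).
have nQ k : 0 < k <= q -> nth 0 Qcompl k.-1 \in Q = false.
  move=> kq; apply/negP => /phiQ_disjoint; rewrite mem_nth ?size_compl //; lia.
by rewrite !nQ // !(andbF, orbF).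
Qed.

End PhiQ.

(** * The word congruences are insertional *)

Section Families.
Variable W : seq bool -> Prop.

(** The predicate is pulled back along [f]. The word of [i], [j], [L \o f] is a subword of the word
    of [a], [b], [L], hence uncontracted, and the hypothesis on [u] and [u'] applies to it. *)
Lemma word_cong_embed p u u' f x a b (L : pred nat) : word_cong W p u u' ->
  (forall i j, 0 < i -> i < j -> j <= p -> f i < f j) ->
  (forall i j, 0 < i <= p -> 0 < j <= p -> inv_pair x (f i) (f j) = inv_pair u i j) ->
  ~ word_contracted W a b L -> inverts x a b L ->
  forall i j, 0 < i <= p -> 0 < j <= p -> a <= f i -> f i < f j -> f j <= b ->
    ~~ L (f i) -> L (f j) -> inv_pair u' i j.
Proof.
move=> uu fm fx nc ix i j ip jp ai fij jb Li Lj.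
have ij : i < j by case: (ltngtP i j) fij => // [/fm|->]; lia.
have fle k l : 0 < k -> k <= l -> l <= p -> f k <= f l.
  by move=> k0; rewrite leq_eqVlt => /predU1P[->//|kl] lp; rewrite ltnW ?fm.
have nc' : ~ word_contracted W i j (L \o f).
  move=> h; apply: nc; apply: (word_contracted_map (f := f) _ _ h)
    => [k kij | k l ik kl lj]; last by apply: fm; lia.
  split=> //; have := fm i k; have := fm k j; lia.
have iu : inverts u i j (L \o f).
  move=> c d ic cd dj Lc Ld; rewrite -fx; try lia.
  apply: ix => //; [have := fle i c| apply: fm | have := fle d j]; lia.
by apply: ((uu i j (L \o f) _ ij _ Li Lj nc').1 iu); rewrite //=; lia.
Qed.

Lemma word_cong_insertional : insertional (word_cong W).
Proof.
move=> p q Q sQ aQ szQ.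
suff gen u u' v v' : is_perm p u -> is_perm p u' -> is_perm q v -> is_perm q v' ->
    word_cong W p u u' -> word_cong W q v v' -> forall a b (L : pred nat),
    ~ word_contracted W a b L -> inverts (phiQ p q Q u v) a b L -> inverts (phiQ p q Q u' v') a b L.
  move=> u u' v v' pu pu' pv pv' uu vv a b L a0 ab bn La Lb nc; split; apply: gen nc => //;
  exact: word_cong_sym.
move=> pu pu' pv pv' uu vv a b L nc ix c d ac cd db Lc Ld.
have icd := ix c d ac cd db Lc Ld.
have [ci di] : c \in iota 1 (p + q) /\ d \in iota 1 (p + q).
  have /andP[_ /perm_mem pm] := is_perm_phiQ sQ aQ szQ pu pv.
  by move: icd; rewrite /inv_pair !pm => /andP[/andP[/andP[_ ->] ->]].
have idx s e : e \in s -> exists2 i, 0 < i <= size s & nth 0 s i.-1 = e.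
  by move=> es; exists (index e s).+1; rewrite ?nth_index //= index_mem.
have szc := size_compl sQ aQ szQ.
(* Mixed pairs are settled at once; a pair on one side is pulled back to the argument inserted
   there. *)
have [cdQ|cdQ] := eqVneq (c \in Q) (d \in Q); last first.
  by move: icd; rewrite !(inv_pair_phiQ_mixed sQ).
have [cQ|cQ] := boolP (c \in Q); move: cdQ; rewrite ?cQ ?(negPf cQ) => /esym dQ.
  have [i ip ec] := idx _ _ cQ; have [j jp ed] := idx _ _ dQ.
  rewrite szQ in ip jp; rewrite -ec -ed (inv_pair_phiQl sQ aQ szQ) //.
  apply: (word_cong_embed uu (f := fun i => nth 0 Q i.-1) _ _ nc ix); rewrite ?ec ?ed //.
    by move=> k l k0 kl lp; apply: nth_pred_mono; rewrite ?szQ.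
  by move=> k l kp lp; rewrite (inv_pair_phiQl sQ aQ szQ).
have [cC dC] : c \in Qcompl p q Q /\ d \in Qcompl p q Q.
  by rewrite !mem_filter (negPf cQ) dQ.
have [i ip ec] := idx _ _ cC; have [j jp ed] := idx _ _ dC.
rewrite szc in ip jp; rewrite -ec -ed (inv_pair_phiQr sQ aQ szQ) //.
apply: (word_cong_embed vv (f := fun i => nth 0 (Qcompl p q Q) i.-1) _ _ nc ix); rewrite ?ec ?ed //.
  by move=> k l k0 kl lp; apply: nth_pred_mono; rewrite ?szc ?sorted_compl.
by move=> k l kp lp; rewrite (inv_pair_phiQr sQ aQ szQ).
Qed.

End Families.

(** * Products of permutations, and translationality *)

(** The product is the insertion along [p], so one half of translationality is a case of
    insertionality. *)
Lemma cross_phiQ p q u v : is_perm p u -> is_perm q v ->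
  phiQ p q (iota 1 p) u v = cross p u v.
Proof.
move=> pu pv; rewrite /phiQ /cross; congr (_ ++ _).
  apply: map_id_in => i; rewrite (is_perm_mem _ pu) => ip; rewrite nth_iota; lia.
have -> : [seq i <- iota 1 (p + q) | i \notin iota 1 p] = iota p.+1 q.
  rewrite iotaD filter_cat (eq_in_filter (a2 := pred0)); last first.
    by move=> i /= ->.
  rewrite filter_pred0 add1n; apply/all_filterP/allP => i; rewrite !mem_iota; lia.
by apply/eq_in_map => i; rewrite (is_perm_mem _ pv) => iq; rewrite nth_iota; lia.
Qed.

Section Cross.
Variables (p q : nat) (u v : seq nat).
Hypotheses (pu : is_perm p u) (pv : is_perm q v).

Let sp : sorted ltn (iota 1 p).
Proof. exact: iota_ltn_sorted. Qed.
Let ap : all (fun i => 0 < i <= p + q) (iota 1 p).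
Proof. by apply/allP => i; rewrite mem_iota; lia. Qed.

Lemma inv_pair_crossl i j : 0 < i -> 0 < j -> i <= p -> j <= p ->
  inv_pair (cross p u v) i j = inv_pair u i j.
Proof.
move=> i0 j0 ip jp; rewrite -(inv_pair_phiQl sp ap (size_iota 1 p) pu pv) ?i0 ?j0 //.
by rewrite !nth_iota ?cross_phiQ //; try lia; rewrite !add1n !prednK.
Qed.

Lemma inv_pair_crossr i j : inv_pair (cross p u v) (p + i) (p + j) = inv_pair v i j.
Proof.
have uc : uniq (cross p u v).
  by rewrite -(cross_phiQ pu pv); exact: is_perm_uniq (is_perm_phiQ sp ap (size_iota 1 p) pu pv).
rewrite inv_pair_cat // /inv_pair !(is_perm_mem _ pu) !(mem_map (@addnI p)).
rewrite !(index_map (@addnI p)) ltn_add2l (is_perm_mem _ pv).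
case: (j \in v); rewrite ?(andbF, andbT) ?orbF //=; lia.
Qed.

Lemma inverts_crossl a b L : 0 < a -> b <= p ->
  inverts (cross p u v) a b L <-> inverts u a b L.
Proof.
move=> a0 bp; split=> h c d ac cd db Lc Ld; have := h c d ac cd db Lc Ld;
  have dp := leq_trans db bp; have c0 := leq_trans a0 ac;
  by rewrite inv_pair_crossl // ?(ltn_trans c0 cd) // (leq_trans (ltnW cd)).
Qed.

Lemma inverts_crossr a b (L : pred nat) :
  inverts (cross p u v) (p + a) (p + b) (fun i => L (i - p)) <-> inverts v a b L.
Proof.
split=> h c d ac cd db Lc Ld.
  by rewrite -inv_pair_crossr; apply: h; rewrite ?leq_add2l ?ltn_add2l ?addKn.
have pc := leq_trans (leq_addr a p) ac; have pd := leq_trans pc (ltnW cd).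
move: ac cd db Lc Ld; rewrite -(subnKC pc) -(subnKC pd) inv_pair_crossr !addKn.
by rewrite !leq_add2l ltn_add2l; exact: h.
Qed.

End Cross.

Section HFamily.
Variable W : seq bool -> Prop.

Lemma word_cong_translational : translational (word_cong W).
Proof.
move=> p q u u' v v' pu pu' pv pv'; split=> [uv | [uu vv]]; last first.
  rewrite -(cross_phiQ pu pv) -(cross_phiQ pu' pv'); apply: word_cong_insertional => //.
  - exact: iota_ltn_sorted.
  - by apply/allP => i; rewrite mem_iota; lia.
  - exact: size_iota.
(* For the other half, a join-irreducible of a factor is read in the product: unchanged for the
   first factor, shifted by [p] for the second. *)
split=> a b L a0 ab bn La Lb nc.
  rewrite -(inverts_crossl pu pv _ a0 bn) -(inverts_crossl pu' pv' _ a0 bn).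
  by apply: uv => //; exact: leq_trans bn (leq_addr q p).
rewrite -(inverts_crossr pu pv) -(inverts_crossr pu' pv').
apply: uv; rewrite ?leq_add2l ?ltn_add2l ?addKn //; first exact: leq_trans (leq_addl p a).
move=> h; apply: nc; apply: (word_contracted_map (f := subn^~ p) _ _ h) => [i | i j]; last lia.
by move=> pai; split; [lia|].
Qed.

Lemma word_cong_H_family : H_family (word_cong W).
Proof.
split; first exact: word_cong_congruence.
by split; [exact: word_cong_translational | exact: word_cong_insertional].
Qed.

End HFamily.

(** * Covers and descents of join-irreducibles *)

Lemma split_pair (s : seq nat) i : i.+1 < size s ->
  s = take i s ++ nth 0 s i :: nth 0 s i.+1 :: drop i.+2 s.
Proof.
by move=> h; rewrite -!drop_nth ?cat_take_drop //; apply: ltnW.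
Qed.

Lemma covered_byP y x : covered_by y x <->
  exists l a b r, [/\ a < b, y = l ++ a :: b :: r & x = l ++ b :: a :: r].
Proof.
split=> [[i [iy [ab ->]]] | [l [a [b [r [ab -> ->]]]]]].
  exists (take i y), (nth 0 y i), (nth 0 y i.+1), (drop i.+2 y).
  by split=> //; exact: split_pair.
exists (size l); rewrite size_cat /= /swap_adj !nth_cat ltnn subnn ifN ?subSnn //; last lia.
rewrite take_size_cat // drop_cat ifN; last lia.
by rewrite -[(size l).+2]addn2 addKn /= drop0; split; [lia | split].
Qed.

Lemma descents_uniq x i j : descents x = 1 -> i.+1 < size x -> j.+1 < size x ->
  nth 0 x i.+1 < nth 0 x i -> nth 0 x j.+1 < nth 0 x j -> i = j.
Proof.
rewrite /descents -size_filter; set s := filter _ _.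
case Es : s => [|z [|? ?]] //= _ ix jx di dj.
have mem k : k.+1 < size x -> nth 0 x k.+1 < nth 0 x k -> k = z.
  move=> kx dk; have : k \in s by rewrite mem_filter dk mem_iota /=; lia.
  by rewrite Es inE => /eqP.
by rewrite (mem i) // (mem j).
Qed.

Lemma cat_cons2_inj (l l' : seq nat) b a r b' a' r' : size l = size l' ->
  l ++ b :: a :: r = l' ++ b' :: a' :: r' -> [/\ l = l', b = b', a = a' & r = r'].
Proof. by move=> sl /eqP; rewrite eqseq_cat // => /andP[/eqP-> /eqP[-> -> ->]]. Qed.

Lemma nth_size_cat (l : seq nat) b a r :
  (nth 0 (l ++ b :: a :: r) (size l) = b) * (nth 0 (l ++ b :: a :: r) (size l).+1 = a).
Proof. by rewrite !nth_cat ltnn subnn ifN ?subSnn //; lia. Qed.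

(** A cover undoes one descent, and here there is only one. This identifies the witness in
    [contracts] with the unique lower cover. *)
Lemma covered_by_ji y l b a r : descents (l ++ b :: a :: r) = 1 -> a < b ->
  covered_by y (l ++ b :: a :: r) -> y = l ++ a :: b :: r.
Proof.
move=> d1 ab /covered_byP[l' [a' [b' [r' [ab' -> e]]]]].
have sl : size l = size l'.
  have size2 (s t : seq nat) c d : (size s).+1 < size (s ++ c :: d :: t).
    by rewrite size_cat /=; lia.
  apply: (descents_uniq d1); first exact: size2.
  - by rewrite e size2.
  - by rewrite !nth_size_cat.
  - by rewrite e !nth_size_cat.
by have [-> -> -> ->] := cat_cons2_inj sl e.
Qed.

(** The maximum is not last, so a descent follows it; 1 is not first, so a descent precedes it. With
    a single descent these coincide, and the maximum is directly followed by 1. *)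
Lemma untranslated_ji g : join_irreducible g -> untranslated g ->
  exists l r, g = l ++ size g :: 1 :: r.
Proof.
move=> [pg d1] [g1 gk]; set k := size g in pg gk *.
have k0 : 0 < k by rewrite lt0n; apply/eqP => k0; move: g1; rewrite nth_default // -/k k0.
have ug := is_perm_uniq pg.
have kg : k \in g by rewrite (is_perm_mem _ pg); lia.
have og : 1 \in g by rewrite (is_perm_mem _ pg); lia.
have ib i : i < k -> 0 < nth 0 g i <= k by move=> ik; rewrite -(is_perm_mem _ pg) mem_nth.
have kk : index k g < k by rewrite index_mem.
have ok : index 1 g < k by rewrite index_mem.
have nk := nth_index 0 kg; have no := nth_index 0 og.
have kl : (index k g).+1 < k.
  rewrite ltn_neqAle kk andbT; apply/eqP => e.
  have ek : k.-1 = index k g by lia.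
  by move: gk; rewrite ek nk ltnn.
have o0 : 0 < index 1 g.
  by rewrite lt0n; apply/eqP => e; move: no g1; rewrite e => ->.
have e : index k g = (index 1 g).-1.
  apply: (descents_uniq d1); rewrite ?prednK //.
    have h := ib _ kl; rewrite nk ltn_neqAle; apply/andP; split; last lia.
    by apply/eqP => e; have := index_uniq 0 kl ug; rewrite e; lia.
  have lt : (index 1 g).-1 < k by lia.
  have h := ib _ lt; rewrite no ltn_neqAle; apply/andP; split; last lia.
  by apply/eqP => e; have := index_uniq 0 lt ug; rewrite -e; lia.
exists (take (index k g) g), (drop (index k g).+2 g).
by rewrite {1}(split_pair kl) nk {2}e prednK // no.
Qed.

(** * Standardization, and edges of an arbitrary insertional family or congruence *)

Definition st (s : seq nat) := map (fun c => (index c (sort leq s)).+1) s.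

Lemma map_index_iota (s : seq nat) : uniq s ->
  map (fun c => (index c s).+1) s = iota 1 (size s).
Proof.
move=> us; apply: (@eq_from_nth _ 0); rewrite size_map ?size_iota // => i i_s.
by rewrite (nth_map 0) // nth_iota // index_uniq.
Qed.

Lemma is_perm_st s : uniq s -> is_perm (size s) (st s).
Proof.
move=> us; rewrite /is_perm size_map eqxx /=.
have ss : perm_eq s (sort leq s) by rewrite perm_sym perm_sort.
rewrite (perm_trans (perm_map _ ss)) //.
by rewrite map_index_iota ?sort_uniq // size_sort perm_refl.
Qed.

Lemma index_sorted_mono s : sorted ltn s ->
  {in s &, {mono (fun c => (index c s).+1) : c d / c < d}}.
Proof.
move=> ss c d cs ds; rewrite ltnS -{2}(nth_index 0 cs) -{2}(nth_index 0 ds).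
have [h|h|->] := ltngtP (index c s) (index d s); last by rewrite ltnn.
  by apply/esym/(sorted_ltn_nth ltn_trans 0 ss); rewrite ?inE ?index_mem.
apply/esym/negbTE; rewrite -leqNgt ltnW //.
by apply/(sorted_ltn_nth ltn_trans 0 ss); rewrite ?inE ?index_mem.
Qed.

Lemma st_mono s : uniq s ->
  {in s &, {mono (fun c => (index c (sort leq s)).+1) : c d / c < d}}.
Proof.
move=> us c d cs ds; apply: index_sorted_mono; rewrite ?mem_sort //.
by rewrite ltn_sorted_uniq_leq sort_uniq us sort_sorted //; exact: leq_total.
Qed.

(** Serves to recognize the standardization of an embedded copy of a permutation as that
    permutation. *)
Lemma st_map (f : nat -> nat) (s : seq nat) : {in s &, {mono f : i j / i < j}} ->
  st (map f s) = st s.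
Proof.
move=> fm; have fi := mono_ltn_inj fm.
rewrite /st (@homo_sort_map_in _ _ (mem s) f leq leq); last exact/allP.
- rewrite -map_comp; apply/eq_in_map => c cs /=; rewrite index_map_in ?mem_sort //.
  by move=> i j; rewrite !mem_sort; exact: fi.
- by move=> i j si sj /anti_leq; exact: fi.
- by move=> i j k _ _ _; exact: leq_trans.
- by move=> i j _ _; exact: leq_total.
move=> i j si sj; rewrite leq_eqVlt => /predU1P[->//|ij].
by apply: ltnW; rewrite fm.
Qed.

Lemma st_perm n s : is_perm n s -> st s = s.
Proof.
move=> /andP[_ ps]; rewrite /st.
have -> : sort leq s = iota 1 n.
  by apply: (sorted_eq leq_trans anti_leq); rewrite ?perm_sort ?iota_sorted ?sort_sorted //; exact: leq_total.
apply: map_id_in => c; rewrite (perm_mem ps) mem_iota => cn.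
have lt : c.-1 < n by lia.
have := @index_uniq _ 0 c.-1 (iota 1 n); rewrite size_iota iota_uniq nth_iota // add1n.
by rewrite prednK; [move=> ->; lia | lia].
Qed.

(** Any cut of a permutation exhibits it as an insertion, [Q] being the set of entries before the
    cut. *)
Lemma phiQ_st n A B : is_perm n (A ++ B) ->
  phiQ (size A) (size B) (sort leq A) (st A) (st B) = A ++ B.
Proof.
move=> pAB; have nE : size A + size B = n by rewrite -size_cat (is_perm_size pAB).
rewrite /phiQ nE.
have -> : [seq i <- iota 1 n | i \notin sort leq A] = sort leq B.
  apply: (sorted_eq leq_trans anti_leq).
  - by apply: sorted_filter; [exact: leq_trans | exact: iota_sorted].
  - by apply: sort_sorted; exact: leq_total.
  have := is_perm_uniq pAB; rewrite cat_uniq => /and3P[_ /hasPn dis uB].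
  apply: uniq_perm; rewrite ?filter_uniq ?iota_uniq ?sort_uniq // => i.
  rewrite mem_filter !mem_sort.
  have -> : (i \in iota 1 n) = (i \in A ++ B) by case/andP: pAB => _ /perm_mem ->.
  by rewrite mem_cat; have := dis i; case: (i \in A); case: (i \in B) => //= /(_ isT).
have id s : map (fun i => nth 0 (sort leq s) i.-1) (st s) = s.
  by rewrite -map_comp map_id_in // => i si /=; rewrite nth_index ?mem_sort.
by rewrite !id.
Qed.

(** As [A] and [A'] have the same entries, both concatenations are insertions along the same [Q]. *)
Lemma insertional_cat (T : family) n A A' B B' : insertional T ->
  is_perm n (A ++ B) -> perm_eq A A' -> perm_eq B B' ->
  T (size A) (st A) (st A') -> T (size B) (st B) (st B') -> T n (A ++ B) (A' ++ B').
Proof.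
move=> insT pAB eA eB TA TB.
have pAB' : is_perm n (A' ++ B') by apply: is_perm_eq pAB; exact: perm_cat.
have sA := perm_size eA; have sB := perm_size eB.
have sortA : sort leq A = sort leq A'.
  by apply/perm_sortP => //; [exact: leq_total | exact: leq_trans | exact: anti_leq].
have nE : size A + size B = n by rewrite -size_cat (is_perm_size pAB).
rewrite -(phiQ_st pAB) -(phiQ_st pAB') -sA -sB -sortA -nE.
have [uA uB] : uniq A /\ uniq B.
  by have := is_perm_uniq pAB; rewrite cat_uniq => /and3P[].
apply: insT => //.
- by rewrite ltn_sorted_uniq_leq sort_uniq uA sort_sorted //; exact: leq_total.
- apply/allP => i; rewrite mem_sort nE -(is_perm_mem _ pAB) mem_cat => ->; exact: isT.
- by rewrite size_sort.
- exact: is_perm_st.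
- by rewrite sA is_perm_st // -(perm_uniq eA).
- exact: is_perm_st.
- by rewrite sB is_perm_st // -(perm_uniq eB).
Qed.

(* The two edges are perspective, through the edge with the left and right parts sorted. *)
Lemma congruence_swap n (R : seq nat -> seq nat -> Prop) l l' a b r r' :
  congruence n R -> a < b -> is_perm n (l ++ b :: a :: r) ->
  perm_eq l l' -> perm_eq r r' ->
  R (l' ++ b :: a :: r') (l' ++ a :: b :: r') ->
  R (l ++ b :: a :: r) (l ++ a :: b :: r).
Proof.
move=> [_ _ _ Rjoin Rmeet] ab px el er Rx'.
pose sl := sort leq l; pose sr := sort leq r.
have swp s t : is_perm n (s ++ b :: a :: t) -> is_perm n (s ++ a :: b :: t).
  by apply: is_perm_eq; rewrite perm_cat2l (perm_catCA [:: b] [:: a]).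
have pp s t : perm_eq l s -> perm_eq r t -> is_perm n (s ++ b :: a :: t).
  by move=> ls rt; apply: is_perm_eq px; rewrite perm_cat // !perm_cons.
have sortE s : perm_eq s (sort leq s) by rewrite perm_sym perm_sort.
have px' := pp _ _ el er; have px0 : is_perm n (sl ++ b :: a :: sr) by apply: pp.
have sw s t : is_perm n (s ++ b :: a :: t) -> forall c d,
    inv_pair (s ++ b :: a :: t) c d = inv_pair (s ++ a :: b :: t) c d || (c == a) && (d == b).
  by move=> ps c d; rewrite inv_pair_swap // (is_perm_uniq ps).
have wl s t : is_perm n (s ++ b :: a :: t) -> weak_le (s ++ a :: b :: t) (s ++ b :: a :: t).
  by move=> ps c d; rewrite sw // => ->.
have inv_ab s t : is_perm n (s ++ b :: a :: t) -> inv_pair (s ++ a :: b :: t) a b = false.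
  move=> ps; have := is_perm_uniq (swp _ _ ps); rewrite cat_uniq => /and3P[_ /hasPn h _].
  rewrite /inv_pair !index_cat !ifN ?h ?inE ?eqxx ?orbT //= !eqxx ltn_eqF //; lia.
(* Sorting the two sides only removes inversions, so the sorted edge lies below every edge with the
   same sides. *)
have le0 s t : perm_eq l s -> perm_eq r t -> weak_le (sl ++ a :: b :: sr) (s ++ a :: b :: t).
  move=> ls rt c d.
  have pst := swp _ _ (pp _ _ ls rt); have ps := is_perm_uniq pst.
  have ps0 := is_perm_uniq (swp _ _ px0).
  have un A (B : seq nat) : uniq (A ++ B) -> uniq A * uniq B.
    by rewrite cat_uniq => /and3P[-> _ ->].
  rewrite -![_ :: _ :: sr]/([:: _; _] ++ _) -![_ :: _ :: t]/([:: _; _] ++ _) in ps ps0 *.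
  rewrite !inv_pair_cat ?ps ?ps0 ?(un _ _ ps).2 ?(un _ _ ps0).2 //.
  rewrite ![inv_pair (sort _ _) _ _]inv_pair_sorted ?sort_uniq ?sort_sorted //; try exact: leq_total.
  - rewrite !mem_cat !mem_sort (perm_mem ls) (perm_mem rt).
    by move=> /or3P[//|/or3P[->|//|/and3P[-> -> ->]]|/and3P[-> -> ->]]; rewrite !orbT.
  - by rewrite -(sort_uniq leq); exact: (un _ _ (un _ _ ps0).2).2.
  - by rewrite -(sort_uniq leq); exact: (un _ _ ps0).1.
have le0' s t : perm_eq l s -> perm_eq r t -> weak_le (sl ++ b :: a :: sr) (s ++ b :: a :: t).
  move=> ls rt c d; rewrite !sw //; last exact: pp.
  by case/orP => [/(le0 _ _ ls rt)->//|->]; rewrite orbT.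
(* Meeting both ends of the given edge with the top of the sorted edge yields the sorted edge. *)
have R0 : R (sl ++ b :: a :: sr) (sl ++ a :: b :: sr).
  apply: (Rmeet _ _ (sl ++ b :: a :: sr)) Rx' _ _ => //; first exact: swp.
    by split=> //; split; [exact: le0' | split].
  split; first exact: swp.
  split; first exact: le0.
  split; first exact: wl.
  move=> w pw wy w0 c d wcd; move: (w0 _ _ wcd); rewrite sw // => /orP[//|/andP[/eqP ec /eqP ed]].
  by move: (wy _ _ wcd); rewrite ec ed (inv_ab _ _ px').
(* Joining both ends of the sorted edge with the bottom of the wanted edge yields the wanted
   edge. *)
apply: (Rjoin _ _ (l ++ a :: b :: r)) R0 _ _; rewrite ?swp //.
  split=> //; split; first exact: le0'.
  split; first exact: wl.
  move=> w pw w0 wy c d; rewrite sw // => /orP[/wy//|/andP[/eqP-> /eqP->]].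
  by apply: w0; rewrite sw // !eqxx orbT.
split; first exact: swp.
by split; [exact: le0 | split].
Qed.

(** * Edges that every H-family contracting [g] must contract *)

(** One letter for each value strictly between 1 and the maximum, telling whether it stands left of
    the maximum. *)
Definition cliff_word (g : seq nat) :=
  [seq c \in take (index (size g) g) g | c <- iota 2 (size g - 2)].

Lemma index_cliff (l : seq nat) b a r : uniq (l ++ b :: a :: r) ->
  index b (l ++ b :: a :: r) = size l.
Proof.
rewrite cat_uniq => /and3P[_ /hasPn h _].
by rewrite index_cat ifN ?h ?inE ?eqxx //; move: (addn0 (size l)); rewrite /= eqxx.
Qed.

Lemma cliff_wordE g l r : uniq g -> g = l ++ size g :: 1 :: r ->
  cliff_word g = [seq c \in l | c <- iota 2 (size g - 2)].
Proof.
move=> ug gE; have ig : index (size g) g = size l.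
  by rewrite {2}gE index_cliff // -gE.
by rewrite /cliff_word ig {1}gE take_size_cat.
Qed.

Lemma mem_cliffr (l : seq nat) b a r c : uniq (l ++ b :: a :: r) ->
  c \in l ++ b :: a :: r -> (c \in r) = [&& c \notin l, c != b & c != a].
Proof.
rewrite cat_uniq mem_cat !inE => /and3P[_ /hasPn lr /= /and3P[]].
rewrite inE negb_or => /andP[_ br] ar _.
case: (boolP (c \in l)) => cl.
  by move=> _; apply/negbTE/negP => cr; have := lr c; rewrite !inE cr !orbT cl => /(_ isT).
case: (eqVneq c b) => [-> _|_]; first exact: negbTE.
by case: (eqVneq c a) => [-> _|_ /= ->]; first exact: negbTE.
Qed.

(** [F] places a copy of [g] among the entries, with its descent at [b a] and its left part in [l].
    Only the two sets of entries beside [b a] matter, so the copy may be taken contiguous and in the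
    order of [g]; insertionality then replaces it by the lower cover of [g]. *)
Lemma H_family_swap (T : family) g gl gr n l a b r F :
  H_family T -> contracts T (size g) g -> join_irreducible g ->
  g = gl ++ size g :: 1 :: gr ->
  is_perm n (l ++ b :: a :: r) ->
  (forall i j, 0 < i -> i < j -> j <= size g -> F i < F j) ->
  F 1 = a -> F (size g) = b -> (forall i, i \in g -> F i \in l ++ b :: a :: r) ->
  (forall i, i \in g -> 1 < i < size g -> (F i \in l) = (i \in gl)) ->
  T n (l ++ b :: a :: r) (l ++ a :: b :: r).
Proof.
move=> [congT [_ insT]] [y [yg Ty]] [pg d1] gE px Fm F1 Fk Fx Fl.
set k := size g in pg gE Fm Fk Fl Ty.
have ug := is_perm_uniq pg; have ux := is_perm_uniq px.
have k1 : 1 < k by rewrite /k gE size_cat /=; lia.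
have ab : a < b by rewrite -F1 -Fk; apply: Fm.
have yE : y = gl ++ 1 :: k :: gr by apply: covered_by_ji; rewrite -?gE.
have Fg : {in g &, {mono F : i j / i < j}}.
  move=> i j; rewrite !(is_perm_mem _ pg) => ik jk.
  have [ij|ji|->] := ltngtP i j; last by rewrite ltnn.
    by apply: Fm; lia.
  by apply/negbTE; rewrite -leqNgt ltnW //; apply: Fm; lia.
have Fi := mono_ltn_inj Fg.
have glg i : i \in gl -> i \in g by rewrite gE mem_cat => ->.
have grg i : i \in gr -> i \in g by rewrite gE mem_cat !inE => ->; rewrite !orbT.
have [bl al] : b \notin l /\ a \notin l.
  move: ux; rewrite cat_uniq => /and3P[_ /hasPn h _].
  by split; apply: h; rewrite !inE eqxx ?orbT.
have [kl ol] : k \notin gl /\ 1 \notin gl.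
  move: ug; rewrite gE cat_uniq => /and3P[_ /hasPn h _].
  by split; apply: h; rewrite !inE eqxx ?orbT.
have Fl' i : i \in g -> (F i \in l) = (i \in gl).
  move=> ig; have [->|ni1] := eqVneq i 1; first by rewrite F1 (negPf al) (negPf ol).
  have [->|nik] := eqVneq i k; first by rewrite Fk (negPf bl) (negPf kl).
  by apply: Fl => //; move: ig; rewrite (is_perm_mem _ pg); lia.
have Fr i : i \in g -> (F i \in r) = (i \in gr).
  move=> ig; rewrite (mem_cliffr ux (Fx i ig)).
  rewrite (mem_cliffr (l := gl) (b := k) (a := 1) (r := gr)) -?gE //.
  have kg : k \in g by rewrite (is_perm_mem _ pg) leqnn ltnW.
  have og : 1 \in g by rewrite (is_perm_mem _ pg); exact: ltnW.
  by rewrite Fl' // -Fk -F1 !(inj_in_eq Fi).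
pose out := [pred c | c \notin map F g].
have part s gs : uniq s -> uniq gs -> {subset gs <= g} ->
    (forall i, i \in g -> (F i \in s) = (i \in gs)) ->
    perm_eq (map F gs) (filter (predC out) s).
  move=> us ugs sub Fs; apply: uniq_perm; rewrite ?filter_uniq //.
    by rewrite map_inj_in_uniq // => i j ig jg; apply: Fi; exact: sub.
  move=> c; rewrite mem_filter /= negbK; apply/mapP/andP => [[i ig ->]|[/mapP[i ig ->]]].
    by rewrite map_f ?Fs // sub.
  by rewrite Fs // => igs; exists i.
have [ul ur] : uniq l /\ uniq r.
  by move: ux; rewrite cat_uniq /= => /and3P[-> _ /and3P[_ _ ->]].
have [ugl ugr] : uniq gl /\ uniq gr.
  by move: ug; rewrite gE cat_uniq /= => /and3P[-> _ /and3P[_ _ ->]].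
have filt s : perm_eq s (filter out s ++ filter (predC out) s).
  by rewrite perm_sym perm_filterC.
have el : perm_eq l (filter out l ++ map F gl).
  by apply: perm_trans (filt l) _; rewrite perm_cat2l perm_sym part.
have er : perm_eq r (map F gr ++ filter out r).
  apply: perm_trans (filt r) _; rewrite perm_catC perm_cat2r perm_sym part //.
(* Entries outside the copy move to the far left and far right, by perspectivity. *)
apply: (congruence_swap (congT n) ab px el er).
have eb : (filter out l ++ map F gl) ++ b :: a :: map F gr ++ filter out r =
    filter out l ++ (map F g ++ filter out r).
  by rewrite gE map_cat /= Fk F1 -!catA.
rewrite eb; have -> : (filter out l ++ map F gl) ++ a :: b :: map F gr ++ filter out r =
    filter out l ++ (map F y ++ filter out r).
  by rewrite yE map_cat /= Fk F1 -!catA.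
have gy : perm_eq g y.
  by rewrite yE {1}gE perm_cat2l (perm_catCA [:: k] [:: 1]).
have py := is_perm_eq gy pg.
have refl m z : is_perm m z -> T m z z by case: (congT m) => h _ _ _ _; exact: h.
set A := filter out l; set B := map F g ++ filter out r.
have pAB : is_perm n (A ++ B).
  by apply: is_perm_eq px; rewrite /A /B -eb perm_cat // !perm_cons.
have [uA uB] : uniq A /\ uniq B.
  by have := is_perm_uniq pAB; rewrite cat_uniq => /and3P[].
have gyB : perm_eq B (map F y ++ filter out r) by rewrite perm_cat2r perm_map.
(* First cut, before the copy: the left factor is the same on both sides. *)
apply: insertional_cat => //; first exact: refl (is_perm_st uA).
have sortB : sort leq B = sort leq (map F y ++ filter out r).
  by apply/perm_sortP => //; [exact: leq_total | exact: leq_trans | exact: anti_leq].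
pose h c := (index c (sort leq B)).+1.
have hm : {in B &, {mono h : c d / c < d}} := st_mono uB.
have stB := is_perm_st uB; rewrite /st -sortB -/h.
rewrite /st -/h [X in is_perm _ X]map_cat in stB.
rewrite [X in T _ X]map_cat [X in T _ _ X]map_cat.
have sub i : i \in g -> F i \in B by move=> ig; rewrite mem_cat map_f.
have hF : {in g &, {mono h \o F : i j / i < j}}.
  by move=> i j ig jg /=; rewrite hm ?sub ?Fg.
(* Second cut, after the copy, within the standardized right factor. Since [h \o F] is increasing on
   [g], the copy standardizes to [g] on one side and to [y] on the other. *)
apply: insertional_cat => //; first by rewrite !perm_map.
  rewrite -!map_comp !size_map !st_map ?(st_perm pg) ?(st_perm py) // => i j.
  by rewrite -!(perm_mem gy); exact: hF.
by apply/refl/is_perm_st; move: (is_perm_uniq stB); rewrite cat_uniq => /and3P[].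
Qed.

(** * Occurrences of scrambles as subwords *)

(** A scramble keeps the left set of [g] and forgets the order within each side; an embedding of
    values that respects the sides is what remains of the occurrence. *)
Lemma occurs_embedding n x g sigma gl gr : is_perm n x -> is_perm (size g) g ->
  g = gl ++ size g :: 1 :: gr -> scramble g sigma -> occurs_adj_cliff sigma x ->
  exists l a b r F, [/\ x = l ++ b :: a :: r,
    forall i j, 0 < i -> i < j -> j <= size g -> F i < F j,
    F 1 = a /\ F (size g) = b,
    forall i, i \in g -> F i \in x &
    forall i, i \in g -> 1 < i < size g -> (F i \in l) = (i \in gl)].
Proof.
move=> px pg gE [ps [j [jk [gj [gj1 [sj [sj1 pt]]]]]]].
set k := size g in pg gE ps jk gj gj1 sj sj1 *.
move=> [idx]; rewrite (is_perm_size ps) => -[szi si ai iso [j' [j'k sj' _ adj]]].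
have us := is_perm_uniq ps; have ug := is_perm_uniq pg; have ux := is_perm_uniq px.
(* Both definitions locate the cliff by the position of the value [k], which occurs only once. *)
have jE : j' = j.
  by apply/eqP; rewrite -(nth_uniq 0 _ _ us) ?(is_perm_size ps) ?sj' ?sj //; lia.
rewrite jE in j'k sj' adj => {j' jE}.
have glj : size gl = j.
  apply/eqP; rewrite -(nth_uniq 0 _ _ ug) -/k; try lia.
    by rewrite gj {1}gE nth_size_cat.
  by rewrite /k gE size_cat /=; lia.
have glE : take j g = gl by rewrite gE -glj take_size_cat.
have ix p : p < k -> nth 0 idx p < size x.
  by move=> pk; apply: (allP ai); rewrite mem_nth // szi.
have i1 : (nth 0 idx j).+1 < size x by rewrite -adj ix.
(* The entry of [x] that plays the value [i] of [sigma]. *)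
pose F i := nth 0 x (nth 0 idx (index i sigma)).
have ltk i : 0 < i <= k -> index i sigma < k.
  by move=> ik; rewrite -(is_perm_size ps) index_mem (is_perm_mem _ ps).
have ij : index k sigma = j by rewrite -sj index_uniq // (is_perm_size ps); lia.
have i1j : index 1 sigma = j.+1 by rewrite -sj1 index_uniq // (is_perm_size ps); lia.
exists (take (nth 0 idx j) x), (F 1), (F k), (drop (nth 0 idx j).+2 x), F; split.
- by rewrite /F ij i1j adj -split_pair.
- move=> i i' i0 ii' i'k; rewrite /F iso ?ltk //; try lia.
  by rewrite !nth_index // (is_perm_mem _ ps); lia.
- by [].
- by move=> i; rewrite (is_perm_mem _ pg) => ik; rewrite mem_nth // ix // ltk.
move=> i ig ik; have ik' : 0 < i <= k by lia.
rewrite in_take ?mem_nth ?ix ?ltk // index_uniq ?ix ?ltk //.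
rewrite -glE -(perm_mem pt) in_take ?(is_perm_mem _ ps) //.
have im p q : p < q -> q < k -> nth 0 idx p < nth 0 idx q.
  by move=> pq qk; apply: (sorted_ltn_nth ltn_trans 0 si); rewrite ?inE ?szi //; lia.
have := ltk i ik'; have [h|h|->] := ltngtP (index i sigma) j; last by rewrite ltnn.
  by move=> _; apply: im; lia.
by move=> ?; apply/negbTE; rewrite -leqNgt ltnW // im.
Qed.

(** The entries [a], [b] and those of [s], read in the order of [x], standardize to [sigma].
    Equality of words says that its left set is that of [g]. *)
Lemma embedding_occurs n l a b r g gl gr s :
  is_perm n (l ++ b :: a :: r) -> is_perm (size g) g ->
  g = gl ++ size g :: 1 :: gr -> a < b -> sorted ltn s ->
  all (fun c => a < c < b) s -> map (fun c => c \in l) s = cliff_word g ->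
  exists2 sigma, scramble g sigma & occurs_adj_cliff sigma (l ++ b :: a :: r).
Proof.
move=> px pg gE ab ss sab sw; have ux := is_perm_uniq px; have ug := is_perm_uniq pg.
set k := size g in pg gE.
have k2 : 1 < k by rewrite /k gE size_cat /=; lia.
rewrite (cliff_wordE ug gE) -/k in sw.
have szs : size s = k - 2 by rewrite -(size_map (fun c => c \in l)) sw size_map size_iota.
(* The chosen values in increasing order: [a] gets rank 1 and [b] gets rank [k]. *)
pose vs := a :: rcons s b.
have szv : size vs = k by rewrite /= size_rcons szs; lia.
have sv : sorted ltn vs.
  rewrite /= rcons_path; apply/andP; split.
    case: (s) ss sab => //= c t -> /andP[/andP[-> _] _] //.
  by have := mem_last a s; rewrite inE => /predU1P[->//|/(allP sab)/andP[]].
have uv : uniq vs by have := sv; rewrite ltn_sorted_uniq_leq => /andP[].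
have vab c : c \in vs -> a <= c <= b.
  rewrite inE mem_rcons inE => /or3P[/eqP->|/eqP->|/(allP sab)]; lia.
have [/andP[a0 an] /andP[b0 bn]] : 0 < a <= n /\ 0 < b <= n.
  by rewrite -!(is_perm_mem _ px) !mem_cat !inE !eqxx !orbT.
have vx : {subset vs <= l ++ b :: a :: r}.
  by move=> c /vab; rewrite (is_perm_mem _ px); lia.
have [av bv] : a \in vs /\ b \in vs by split; rewrite inE ?mem_rcons ?inE eqxx ?orbT.
pose f c := (index c vs).+1.
have fm : {in vs &, {mono f : c d / c < d}} := index_sorted_mono sv.
have fa : f a = 1 by rewrite /f /= eqxx.
have mem_s : s =i [pred c | (c \in vs) && (a < c < b)].
  move=> c; rewrite !inE mem_rcons inE; apply/idP/andP => [cs|[]].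
    by rewrite cs !orbT (allP sab _ cs).
  by move=> /or3P[/eqP->|/eqP->|//]; rewrite ltnn ?andbF.
have fb : f b = k.
  have : index (nth 0 vs k.-1) vs = k.-1 by rewrite index_uniq // szv ltn_predL ltnW.
  have -> : nth 0 vs k.-1 = b.
    by rewrite -szv nth_last /= last_rcons.
  by rewrite /f => ->; lia.
pose sel := [pred c | c \in vs].
pose x := l ++ b :: a :: r.
have fx : filter sel x = filter sel l ++ b :: a :: filter sel r.
  by rewrite /x filter_cat /= av bv.
pose sigma := map f (filter sel x).
have sE : sigma = map f (filter sel l) ++ k :: 1 :: map f (filter sel r).
  by rewrite /sigma fx map_cat /= fa fb.
have psel : perm_eq (filter sel x) vs.
  apply: uniq_perm; rewrite ?filter_uniq // => c; rewrite mem_filter /=.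
  by case: (boolP (c \in vs)) => // /vx ->.
have ps : is_perm k sigma.
  rewrite /is_perm size_map (perm_size psel) szv eqxx /=.
  by rewrite (perm_trans (perm_map f psel)) // map_index_iota // szv.
have pl : perm_eq (map f (filter sel l)) gl.
  have ul : uniq l by move: ux; rewrite cat_uniq => /and3P[].
  have ugl : uniq gl by move: ug; rewrite gE cat_uniq => /and3P[].
  have fi : {in vs &, injective f} := mono_ltn_inj fm.
  (* Comparison of the letters at index [m]; the shift by 2 comes from counting from 0 and from the
     rank 1 of [a]. *)
  have mid m : m < k - 2 -> f (nth 0 s m) = m.+2 /\ (nth 0 s m \in l) = (m.+2 \in gl).
    move=> mk; split; last first.
      have := congr1 (fun w => nth false w m) sw.
      by rewrite !(nth_map 0) ?size_iota ?szs // nth_iota.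
    rewrite /f; congr _.+1; have -> : nth 0 s m = nth 0 vs m.+1.
      by rewrite /= nth_rcons szs mk.
    by rewrite index_uniq // szv; move: mk; clear; lia.
  have gln i : i \in gl -> 1 < i < k.
    move=> igl; have : i \in g by rewrite gE mem_cat igl.
    rewrite (is_perm_mem _ pg) => ik.
    move: ug; rewrite gE cat_uniq /= => /and3P[_ /norP[kl /norP[ol _]] _].
    have : i != 1 by apply: contraNneq ol => <-.
    have : i != k by apply: contraNneq kl => <-.
    by move: ik; clear; lia.
  apply: uniq_perm => //.
    rewrite map_inj_in_uniq ?filter_uniq // => c d; rewrite !mem_filter => /andP[cv _] /andP[dv _].
    exact: fi.
  move=> i; apply/mapP/idP => [[c]|igl].
    rewrite mem_filter => /andP[/= cv cl] ->.
    have cs : c \in s.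
      rewrite mem_s inE cv /=; have := vab _ cv.
      move: ux; rewrite cat_uniq /= => /and3P[_ /norP[bl /norP[al _]] _].
      have : c != a by apply: contraNneq al => <-.
      have : c != b by apply: contraNneq bl => <-.
      by clear; lia.
    have [] := mid (index c s); rewrite ?nth_index //; first by rewrite -szs index_mem.
    by move=> -> <-.
  have ik := gln i igl.
  have [i2 iE] : i - 2 < k - 2 /\ (i - 2).+2 = i by move: ik; clear; lia.
  have [fi' il] := mid _ i2; rewrite iE in fi' il; exists (nth 0 s (i - 2)) => //.
  by rewrite mem_filter il igl andbT /= !inE mem_rcons inE mem_nth ?orbT // szs.
exists sigma.
  split=> //; exists (size gl).
  have szl : size gl = size (map f (filter sel l)) by rewrite (perm_size pl).
  have glk : (size gl).+1 < k by rewrite /k gE size_cat /= !addnS !ltnS leq_addr.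
  split=> //; rewrite -/k {1 2}gE !nth_size_cat; split=> //; split=> //.
  rewrite {1 2}szl sE !nth_size_cat; split=> //; split=> //.
  by rewrite szl take_size_cat // -szl gE take_size_cat.
pose idx := [seq i <- iota 0 (size x) | nth 0 x i \in vs].
have mi : map (nth 0 x) idx = filter sel x.
  by rewrite -{2}(mkseq_nth 0 x) filter_map.
have szi : size idx = k by rewrite -(size_map (nth 0 x)) mi (perm_size psel).
have nx p : p < k -> nth 0 x (nth 0 idx p) = nth 0 (filter sel x) p.
  by move=> pk; rewrite -mi (nth_map 0) // szi.
exists idx; rewrite (is_perm_size ps); split=> //.
- by apply: sorted_filter; [exact: ltn_trans | exact: iota_ltn_sorted].
- by apply/allP => i; rewrite mem_filter mem_iota => /andP[_].
- move=> p q pk qk; have szf : size (filter sel x) = k by rewrite (perm_size psel).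
  rewrite !nx // !(nth_map 0) ?szf // fm // -(perm_mem psel) mem_nth ?szf //.
exists (size (filter sel l)).
rewrite sE -(size_map f) !nth_size_cat size_map; split=> //.
  by rewrite -(is_perm_size ps) sE size_cat /= size_map !addnS !ltnS leq_addr.
(* The positions are cut at [size l], which shows those of [b] and [a] as neighbours. *)
have -> : idx = [seq i <- iota 0 (size l) | nth 0 x i \in vs] ++
    size l :: (size l).+1 :: [seq i <- iota (size l).+2 (size r) | nth 0 x i \in vs].
  rewrite /idx /x size_cat iotaD filter_cat /= add0n !nth_size_cat av bv.
  by [].
have -> : size (filter sel l) = size [seq i <- iota 0 (size l) | nth 0 x i \in vs].
  rewrite -[in LHS](mkseq_nth 0 l) filter_map size_map; congr (size _).
  apply: eq_in_filter => i; rewrite mem_iota /= => il.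
  by rewrite /x nth_cat il.
by rewrite !nth_size_cat.
Qed.

(** * Contraction in the smallest H-family, in both directions *)

Theorem theorem9p3 (C : seq nat -> Prop) :
  (forall g, C g -> join_irreducible g /\ untranslated g) ->
  forall (n : nat) (x : seq nat), is_perm n x ->
    (contracts (H_of C) n x <->
     exists g sigma, [/\ C g, scramble g sigma & occurs_adj_cliff sigma x]).
Proof.
move=> CP n x px.
split=> [[y [/covered_byP[l [a [b [r [ab yE xE]]]]] Hxy]] | [g [sigma [Cg sg ox]]]].
  (* Necessity: the word congruences for the words of [C] form an H-family contracting [C], so they
     contract whatever the smallest such family contracts. *)
  pose W w := exists2 g, C g & w = cliff_word g.
  have := Hxy _ (word_cong_H_family W); rewrite xE yE => h; move: px; rewrite xE => px {Hxy x xE y yE}.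
  have cW g : C g -> contracts (word_cong W) (size g) g.
    move=> Cg; have [ji ut] := CP g Cg; have [gl [gr gE]] := untranslated_ji ji ut.
    have k1 : 1 < size g by rewrite gE size_cat /=; lia.
    have pg := ji.1.
    exists (gl ++ 1 :: size g :: gr); split.
      by apply/covered_byP; exists gl, 1, (size g), gr.
    rewrite {2}gE; apply/swap_word_cong => //; first by rewrite -gE.
    (* The whole word of [g] serves as the subword. *)
    exists (iota 2 (size g - 2)); split.
    - by exists g => //; rewrite (cliff_wordE (is_perm_uniq pg) gE).
    - exact: iota_ltn_sorted.
    - by apply/allP => i; rewrite mem_iota; lia.
  have /swap_word_cong := h cW; move=> /(_ px ab)[s [[g Cg sw] ss sab]].
  have [ji ut] := CP g Cg; have [gl [gr gE]] := untranslated_ji ji ut.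
  have [sigma sc oc] := embedding_occurs px ji.1 gE ab ss sab sw.
  by exists g, sigma.
(* Sufficiency: the lower cover is chosen from the occurrence alone, before the H-family [T], so
   that it serves for all of them. *)
have [ji ut] := CP g Cg; have [gl [gr gE]] := untranslated_ji ji ut.
have [l [a [b [r [F [xE Fm [F1 Fk] Fx Fl]]]]]] := occurs_embedding px ji.1 gE sg ox.
have k1 : 1 < size g by rewrite gE size_cat /=; lia.
rewrite xE in px Fx *; exists (l ++ a :: b :: r); split.
  by apply/covered_byP; exists l, a, b, r; split=> //; rewrite -F1 -Fk Fm.
move=> T HT cT; exact: (H_family_swap HT (cT g Cg) ji gE px Fm F1 Fk Fx Fl).
Qed.
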